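(* Under the stochastic block model, we have $$\inf_{\hat\theta}\sup_{\theta\in\Theta_k}\mathbb{E}\left\{\frac1{n^2}\sum_{i,j\in[n]}(\hat\theta_{ij}-\theta_{ij})^2\right\}\asymp \frac{k^2}{n^2}+\frac{\log k}{n}$$ for any $1\le k\le n$. That is, there exists a universal constant $C>0$ (independent of $n$ and $k$) such that for any $1\le k\le n$, $$C^{-1}\left(\frac{k^2}{n^2}+\frac{\log k}{n}\right)\le \inf_{\hat\theta}\sup_{\theta\in\Theta_k}\mathbb{E}\left\{\frac1{n^2}\sum_{i,j\in[n]}(\hat\theta_{ij}-\theta_{ij})^2\right\}\le C\left(\frac{k^2}{n^2}+\frac{\log k}{n}\right),$$ where the infimum is over all estimators $\hat\theta$ (measurable functions of the observed adjacency matrix $A$, with values in $\mathbb{R}^{n\times n}$).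
   Context: Notation: $[m]=\{1,\dots,m\}$. One observes the adjacency matrix $A=\{A_{ij}\}\in\{0,1\}^{n\times n}$ of an undirected graph on $n$ nodes: given a symmetric parameter matrix $\theta=\{\theta_{ij}\}\in[0,1]^{n\times n}$ with zero diagonal, the variables $A_{ij}=A_{ji}\sim\mathrm{Bernoulli}(\theta_{ij})$, $1\le j<i\le n$, are independent, and $A_{ii}=0$ for all $i$. $\mathbb{E}$ is expectation under this law. $\mathcal{Z}_{n,k}$ is the set of all maps $z:[n]\to[k]$. The stochastic block model parameter space is $$\Theta_k=\bigl\{\{\theta_{ij}\}\in[0,1]^{n\times n}:\ \theta_{ii}=0,\ \theta_{ij}=Q_{ab}=Q_{ba}\ \text{for } (i,j)\in z^{-1}(a)\times z^{-1}(b),\ i\ne j,\ \text{for some } Q_{ab}\in[0,1] \text{ and } z\in\mathcal{Z}_{n,k}\bigr\}.$$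
   Formalization: The lower bound is asserted only for n ≥ 2, because for n = k = 1 the zero diagonal forces Θ_1 = {0}, so the minimax risk is 0 while the rate equals 1; the upper bound is kept for all 1 ≤ k ≤ n. *)

(* Defs.v *)
From mathcomp Require Import all_boot all_order all_algebra.
From mathcomp Require Import all_classical all_reals all_analysis.

Set Implicit Arguments.
Unset Strict Implicit.
Unset Printing Implicit Defensive.

Import Order.TTheory GRing.Theory Num.Theory.
Local Open Scope classical_set_scope.
Local Open Scope ring_scope.

Definition sbm_space (R : realType) (n k : nat) : set 'M[R]_n :=
  [set theta | exists (Q : 'M[R]_k) (z : 'I_n -> 'I_k),
    [/\ forall a b, 0 <= Q a b <= 1,
        forall a b, Q a b = Q b a,
        forall i, theta i i = 0
      & forall i j, i != j -> theta i j = Q (z i) (z j)]].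

(* The joint law of the whole matrix A: the entries below the diagonal are
   independent with A_ij ~ Bernoulli(theta_ij), the other entries are then
   determined by A_ij = A_ji and A_ii = 0, so that any other boolean matrix
   has mass 0. *)
Definition graph_pmf (R : realType) (n : nat) (theta : 'M[R]_n)
    (A : 'M[bool]_n) : R :=
  if [forall i, ~~ A i i] && [forall i, forall j, A i j == A j i]
  then \prod_(i < n) \prod_(j < n | (j < i)%N) bernoulli_pmf (theta i j) (A i j)
  else 0.

Definition expectation_under (R : realType) (n : nat) (theta : 'M[R]_n)
    (f : 'M[bool]_n -> R) : R :=
  \sum_(A : 'M[bool]_n) graph_pmf theta A * f A.

Definition mse (R : realType) (n : nat) (M theta : 'M[R]_n) : R :=
  (n%:R ^+ 2)^-1 * \sum_(i < n) \sum_(j < n) (M i j - theta i j) ^+ 2.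

(* The sample space 'M[bool]_n is finite, so every function on it is
   measurable. *)
Definition estimator (R : realType) (n : nat) := 'M[bool]_n -> 'M[R]_n.

Definition minimax_risk (R : realType) (n : nat) (Theta : set 'M[R]_n) : \bar R :=
  ereal_inf [set ereal_sup
      [set (expectation_under theta (fun A => mse (that A) theta))%:E
         | theta in Theta]
    | that in [set: estimator R n]].

Definition sbm_rate (R : realType) (n k : nat) : R :=
  k%:R ^+ 2 / n%:R ^+ 2 + ln k%:R / n%:R.
Arguments sbm_rate R n k : clear implicits.
Arguments sbm_space R n k : clear implicits.

(* Main.v *)
Require Import Defs.
From mathcomp Require Import all_boot all_order all_algebra.
From mathcomp Require Import all_classical all_reals all_analysis.
From mathcomp Require Import ring lra zify.

(** The minimax rate has a parametric part, [k ^ 2 / n ^ 2], and a clustering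
    part, [ln k / n], and each of the two bounds has one mechanism.

    Upper bound.  Least squares over all labelings [z] fits the block averages of
    the adjacency matrix.  Comparing its residuals with those of the true labeling
    ([least_squares_oracle]) bounds the loss by a function of [z] and the noise:
    three times the squared projection of the noise on the block-constant matrices
    of [z], plus a linear term with a compensating negative square.  Divided by 24,
    this function has exponential moment at most [18 ^ (k * k)] for each fixed [z]
    ([expectation_expR_excess]).  To see this, write the exponential of the square
    of each block average as a finite mixture of exponentials of linear functions
    and expand the product over the blocks: only the exponential moments of linear
    functions of the noise remain, and those are a product over the edges.  A union
    bound over the [k ^ n] labelings ([expectation_max_le]) gives a squared error
    of order [n * ln k + k ^ 2].

    Lower bound.  Both parts follow from a version of Assouad's lemma whose
    coordinates take [M] values ([multiary_assouad]); a coordinate is hard to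
    recover when the [M] corresponding laws are close to one reference law in
    chi-square divergence.
    For the parametric part the coordinates are the blocks, and [M = 2]: the
    connection probability of a block with [N] edges moves by about [N ^ (-1/2)],
    which is undetectable and costs a constant squared error per block.
    For the clustering part the labels of some nodes, at most half of them, are
    known; the coordinates are the other nodes, and the values are their labels.
    The connection probabilities are [1 / 2] plus a multiple [d] of a symmetric
    Hadamard matrix of size [M], where [M] is the largest power of 2 that is at
    most [k].  Its rows are orthogonal, so that a wrong label costs a squared error
    of order [n * d ^ 2 = ln M / 16] on the edges to the nodes with known labels,
    while a [d] of that size does not allow the label to be identified.  Fixing the labels of the
    other nodes makes each node a separate testing problem, so that no packing of
    the set of labelings is needed.  This argument requires [2 * k <= n]; for larger
    [k] the parametric part dominates. *)

Set Implicit Arguments.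
Unset Strict Implicit.
Unset Printing Implicit Defensive.

Import Order.TTheory GRing.Theory Num.Theory.
Local Open Scope ring_scope.

(** * The law of the graph *)

Definition below {n} (e : 'I_n * 'I_n) : bool := (e.2 < e.1)%N.

Definition simple_graph {n} (A : 'M[bool]_n) : bool :=
  [forall i, ~~ A i i] && [forall i, forall j, A i j == A j i].

Definition graph_of_edges {n} (f : {ffun 'I_n * 'I_n -> bool}) : 'M[bool]_n :=
  \matrix_(i, j) if (j < i)%N then f (i, j)
                 else if (i < j)%N then f (j, i) else false.

Definition edges_of_graph {n} (A : 'M[bool]_n) : {ffun 'I_n * 'I_n -> bool} :=
  [ffun e => below e && A e.1 e.2].

Lemma edges_of_graphK n (A : 'M[bool]_n) :
  simple_graph A -> graph_of_edges (edges_of_graph A) = A.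
Proof.
case/andP => /forallP dA /forallP sA; apply/matrixP => i j.
rewrite !mxE !ffunE /below /=.
case: (ltngtP j i) => // [_|eij]; first by have /forallP/(_ i)/eqP := sA j.
by rewrite (val_inj eij) (negbTE (dA _)).
Qed.

Lemma simple_graph_of_edges n (f : {ffun 'I_n * 'I_n -> bool}) :
  simple_graph (graph_of_edges f).
Proof.
apply/andP; split; first by apply/forallP => i; rewrite mxE ltnn.
apply/forallP => i; apply/forallP => j; rewrite !mxE.
by case: (ltngtP j i).
Qed.

Lemma graph_pmfE (R : realType) n (theta : 'M[R]_n) A :
  graph_pmf theta A = if simple_graph A
    then \prod_(e | below e) bernoulli_pmf (theta e.1 e.2) (A e.1 e.2) else 0.
Proof.
rewrite /graph_pmf -/(simple_graph A); case: ifP => // _.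
by rewrite pair_big_dep /=; apply: eq_bigl => -[].
Qed.

(** All uses of the independence of the edges go through this factorization. *)
Lemma sum_simple_graph_prod (R : comPzRingType) n
    (g : 'I_n * 'I_n -> bool -> R) :
  \sum_(A : 'M[bool]_n | simple_graph A) \prod_(e | below e) g e (A e.1 e.2) =
  \prod_(e | below e) (g e true + g e false).
Proof.
rewrite (reindex_onto graph_of_edges edges_of_graph); last first.
  by move=> A /edges_of_graphK.
under [RHS]eq_bigr => e _ do rewrite -big_bool.
rewrite (big_distr_big_dep false) /=; apply: eq_big => [f|f _].
  rewrite simple_graph_of_edges /=; apply/eqP/familyP => [<- e|ff].
    by rewrite ffunE [_ \in below]unfold_in /below; case: ifP; rewrite ?inE.
  apply/ffunP => -[i j]; move: (ff (i, j)).
  rewrite [_ \in below]unfold_in ffunE mxE /below /=.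
  by case: ltngtP => //=; rewrite inE => _ /eqP ->.
by apply: eq_bigr => -[i j]; rewrite /below mxE /= => ->.
Qed.

Lemma expectation_under_prod (R : realType) n (theta : 'M[R]_n)
    (g : 'I_n * 'I_n -> bool -> R) :
  expectation_under theta (fun A => \prod_(e | below e) g e (A e.1 e.2)) =
  \prod_(e | below e)
    (theta e.1 e.2 * g e true + (1 - theta e.1 e.2) * g e false).
Proof.
rewrite -(sum_simple_graph_prod (fun e b => bernoulli_pmf (theta e.1 e.2) b * g e b)).
rewrite /expectation_under [RHS]big_mkcond; apply: eq_bigr => A _.
by rewrite graph_pmfE; case: ifP => _; rewrite ?mul0r // big_split.
Qed.

Definition edge_probabilities {R : realType} {n} (theta : 'M[R]_n) : Prop :=
  forall e, below e -> 0 <= theta e.1 e.2 <= 1.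

Lemma graph_pmf_ge0 (R : realType) n (theta : 'M[R]_n) A :
  edge_probabilities theta -> 0 <= graph_pmf theta A.
Proof.
move=> th01; rewrite graph_pmfE; case: ifP => // _.
by apply: prodr_ge0 => e /th01; exact: bernoulli_pmf_ge0.
Qed.

Lemma sum_graph_pmf (R : realType) n (theta : 'M[R]_n) :
  \sum_A graph_pmf theta A = 1.
Proof.
have := expectation_under_prod theta (fun _ _ => 1).
rewrite /expectation_under [RHS]big1 => [<-|e _]; last by rewrite !mulr1 subrKC.
by apply: eq_bigr => A _; rewrite big1 // mulr1.
Qed.

Lemma expectation_under_le (R : realType) n (theta : 'M[R]_n) f g :
  edge_probabilities theta -> (forall A, f A <= g A) ->
  expectation_under theta f <= expectation_under theta g.
Proof.
by move=> th01 fg; apply: ler_sum => A _; rewrite ler_wpM2l // graph_pmf_ge0.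
Qed.

Lemma expectation_underD (R : realType) n (theta : 'M[R]_n) f g :
  expectation_under theta (fun A => f A + g A) =
  expectation_under theta f + expectation_under theta g.
Proof. by rewrite -big_split; apply: eq_bigr => A _; rewrite mulrDr. Qed.

Lemma expectation_underZ (R : realType) n (theta : 'M[R]_n) a f :
  expectation_under theta (fun A => a * f A) = a * expectation_under theta f.
Proof. by rewrite mulr_sumr; apply: eq_bigr => A _; rewrite mulrCA. Qed.

Lemma expectation_under_cst (R : realType) n (theta : 'M[R]_n) a :
  expectation_under theta (fun=> a) = a.
Proof. by rewrite /expectation_under -mulr_suml sum_graph_pmf mul1r. Qed.

Lemma expectation_under_sum (R : realType) n (theta : 'M[R]_n) (I : finType)
    (f : I -> 'M[bool]_n -> R) :
  expectation_under theta (fun A => \sum_i f i A) =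
  \sum_i expectation_under theta (f i).
Proof.
by rewrite exchange_big; apply: eq_bigr => A _; rewrite mulr_sumr.
Qed.

Lemma expR_le_quadratic (R : realType) (x : R) :
  `|x| <= 1 -> expR x <= 1 + x + 2 * x ^+ 2.
Proof.
rewrite ler_norml => /andP[x_ge x_le].
have -> : expR x = expR (x / 2) ^+ 2 by rewrite expr2 -expRD; congr expR; lra.
have h : expR (x / 2) <= 1 + x / 2 + x ^+ 2 / 2.
  have := expR_ge1Dx (- (x / 2)); rewrite expRN => h1.
  have gt0 := expR_gt0 (x / 2).
  have h2 : (1 - x / 2) * expR (x / 2) <= 1.
    by rewrite -ler_pdivlMr // mul1r.
  (* The two sides differ by x ^+ 2 * (1 - x) / 4 after clearing 1 - x / 2. *)
  have h3 : 0 <= x ^+ 2 * (1 - x) by rewrite mulr_ge0 ?sqr_ge0 //; lra.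
  rewrite -(ler_pM2l (_ : 0 < 1 - x / 2)); lra.
apply: le_trans (_ : (1 + x / 2 + x ^+ 2 / 2) ^+ 2 <= _).
  by rewrite ler_sqr // nnegrE ?(le_trans _ h) // ?expR_ge0.
have : 0 <= x ^+ 2 * ((1 - x) * (3 + x)).
  by rewrite mulr_ge0 ?sqr_ge0 // mulr_ge0 //; lra.
lra.
Qed.

(** A centred Bernoulli variable is sub-Gaussian.  For `|t| <= 1` the second-order
    expansion of the exponential suffices, and for larger [t] the crude bound
    [expR `|t|] is already below [expR (t ^+ 2)]. *)
Lemma bernoulli_mgf (R : realType) (p t : R) : 0 <= p <= 1 ->
  p * expR (t * (1 - p)) + (1 - p) * expR (t * (0 - p)) <= expR (t ^+ 2).
Proof.
move=> /andP[p0 p1]; have [t1|t1] := leP `|t| 1.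
  have le1 u : `|u| <= 1 -> expR (t * u) <= 1 + t * u + 2 * (t * u) ^+ 2.
    by move=> u1; apply: expR_le_quadratic; rewrite normrM mulr_ile1.
  have /le1 h1 : `|1 - p| <= 1 by rewrite ler_norml; lra.
  have /le1 h2 : `|0 - p| <= 1 by rewrite ler_norml; lra.
  apply: le_trans (expR_ge1Dx _).
  have pq : p * (1 - p) <= 1 / 4 by have := sqr_ge0 (p - 1 / 2); lra.
  have t2 : 0 <= t ^+ 2 by exact: sqr_ge0.
  have : p * expR (t * (1 - p)) <=
     p * (1 + t * (1 - p) + 2 * (t * (1 - p)) ^+ 2) by rewrite ler_wpM2l.
  have : (1 - p) * expR (t * (0 - p)) <=
     (1 - p) * (1 + t * (0 - p) + 2 * (t * (0 - p)) ^+ 2).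
    by rewrite ler_wpM2l // subr_ge0.
  have : p * (1 + t * (1 - p) + 2 * (t * (1 - p)) ^+ 2) +
      (1 - p) * (1 + t * (0 - p) + 2 * (t * (0 - p)) ^+ 2) =
      1 + 2 * (t ^+ 2 * (p * (1 - p))) by ring.
  have : t ^+ 2 * (p * (1 - p)) <= t ^+ 2 * (1 / 4) by rewrite ler_wpM2l.
  lra.
have le1 u : `|u| <= 1 -> expR (t * u) <= expR (t ^+ 2).
  move=> u1; rewrite ler_expR (le_trans (ler_norm _)) // normrM.
  rewrite -[t ^+ 2]ger0_norm ?sqr_ge0 // normrX.
  have := normr_ge0 u; nra.
have /le1 h1 : `|1 - p| <= 1 by rewrite ler_norml; lra.
have /le1 h2 : `|0 - p| <= 1 by rewrite ler_norml; lra.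
have -> : expR (t ^+ 2) = p * expR (t ^+ 2) + (1 - p) * expR (t ^+ 2).
  by rewrite -mulrDl subrKC mul1r.
by apply: lerD; rewrite ler_wpM2l // subr_ge0.
Qed.

Definition noise {R : realType} {n} (theta : 'M[R]_n) (A : 'M[bool]_n)
  (e : 'I_n * 'I_n) : R := (A e.1 e.2)%:R - theta e.1 e.2.

Lemma expectation_expR_noise (R : realType) n (theta : 'M[R]_n)
    (t : 'I_n * 'I_n -> R) : edge_probabilities theta ->
  expectation_under theta
    (fun A => expR (\sum_(e | below e) t e * noise theta A e)) <=
  expR (\sum_(e | below e) t e ^+ 2).
Proof.
move=> th01.
under [X in expectation_under _ X]funext => A do rewrite expR_sum.
rewrite (expectation_under_prod theta
  (fun e b => expR (t e * (b%:R - theta e.1 e.2)))) expR_sum.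
apply: ler_prod => e /th01 e01; rewrite bernoulli_mgf // andbT.
by case/andP: e01 => ? ?; rewrite addr_ge0 // mulr_ge0 ?expR_ge0 // subr_ge0.
Qed.

(** * Block averages *)

Definition class_size {I K : finType} (P : pred I) (c : I -> K) (b : K) : nat :=
  #|[pred e | P e && (c e == b)]|.

(** The mean of [v] over an empty class is [0]. *)
Definition class_mean {R : realType} {I K : finType} (P : pred I) (c : I -> K)
    (v : I -> R) (b : K) : R :=
  (\sum_(e | P e && (c e == b)) v e) / (class_size P c b)%:R.

Lemma class_size_eq0 (I K : finType) (P : pred I) (c : I -> K) b e :
  class_size P c b = 0 -> P e && (c e == b) = false.
Proof. by move/card0_eq/(_ e). Qed.

Lemma class_mean_sum (R : realType) (I K : finType) (P : pred I) (c : I -> K)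
    (v : I -> R) b :
  (class_size P c b)%:R * class_mean P c v b =
  \sum_(e | P e && (c e == b)) v e.
Proof.
rewrite /class_mean; have [N0|N0] := eqVneq (class_size P c b) 0%N.
  by rewrite N0 mul0r big1 // => e; rewrite class_size_eq0.
by rewrite mulrCA divff ?mulr1 // pnatr_eq0.
Qed.

Lemma sum_by_class (R : realType) (I K : finType) (P : pred I) (c : I -> K)
    (g : K -> R) :
  \sum_(e | P e) g (c e) = \sum_b (class_size P c b)%:R * g b.
Proof.
rewrite (partition_big c xpredT) //; apply: eq_bigr => b _.
rewrite (eq_bigr (fun=> g b)) => [|e /andP[_ /eqP->] //].
by rewrite sumr_const mulr_natl.
Qed.

(** Averaging over the classes is the orthogonal projection on the functions that
    are constant on each class. *)
Lemma sum_class_mean_mul (R : realType) (I K : finType) (P : pred I)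
    (c : I -> K) (v : I -> R) (u : K -> R) :
  \sum_(e | P e) class_mean P c v (c e) * u (c e) =
  \sum_(e | P e) v e * u (c e).
Proof.
rewrite (sum_by_class P c (fun b => class_mean P c v b * u b)).
rewrite [RHS](partition_big c xpredT) //; apply: eq_bigr => b _.
rewrite mulrA class_mean_sum mulr_suml.
by apply: eq_bigr => e /andP[_ /eqP->].
Qed.

Lemma class_meanD (R : realType) (I K : finType) (P : pred I) (c : I -> K)
    (v w : I -> R) b :
  class_mean P c (fun e => v e + w e) b =
  class_mean P c v b + class_mean P c w b.
Proof. by rewrite /class_mean big_split mulrDl. Qed.

Lemma norm_class_mean_le1 (R : realType) (I K : finType) (P : pred I)
    (c : I -> K) (v : I -> R) b :
  (forall e, P e -> `|v e| <= 1) -> `|class_mean P c v b| <= 1.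
Proof.
move=> v1; have [N0|N0] := eqVneq (class_size P c b) 0%N.
  by rewrite /class_mean N0 invr0 mulr0 normr0 ler01.
have N_gt0 : 0 < (class_size P c b)%:R :> R by rewrite ltr0n lt0n.
rewrite /class_mean normrM normfV (gtr0_norm N_gt0) ler_pdivrMr // mul1r.
apply: le_trans (ler_norm_sum _ _ _) _.
apply: le_trans (_ : \sum_(e | P e && (c e == b)) 1 <= _).
  by apply: ler_sum => e /andP[/v1].
by rewrite sumr_const.
Qed.

Definition residual_sum_squares {R : realType} {I K : finType} (P : pred I)
    (y : I -> R) (c : I -> K) : R :=
  \sum_(e | P e) (y e - class_mean P c y (c e)) ^+ 2.

Definition class_bias {R : realType} {I K : finType} (P : pred I)
    (theta : I -> R) (c : I -> K) (e : I) : R :=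
  class_mean P c theta (c e) - theta e.

Definition excess_bound {R : realType} {I K : finType} (P : pred I)
    (theta w : I -> R) (c : I -> K) : R :=
  3 * \sum_(e | P e) class_mean P c w (c e) ^+ 2
  + 4 * \sum_(e | P e) class_bias P theta c e * w e
  - \sum_(e | P e) class_bias P theta c e ^+ 2.

(** If the classes [c] fit the data [y] at least as well as the true classes [c0],
    the loss of the block averages along [c] is controlled by the noise
    [y - theta].  Comparing residuals bounds the squared bias by the squared
    projected noise plus twice the inner product of bias and noise; adding this
    twice to the loss leaves a negative multiple of the squared bias, which later
    absorbs the fluctuations of that inner product. *)
Lemma least_squares_oracle (R : realType) (I K : finType) (P : pred I)
    (y theta : I -> R) (c c0 : I -> K) (u : K -> R) :
  (forall e, P e -> theta e = u (c0 e)) ->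
  residual_sum_squares P y c <= residual_sum_squares P y c0 ->
  \sum_(e | P e) (class_mean P c y (c e) - theta e) ^+ 2 <=
  excess_bound P theta (fun e => y e - theta e) c.
Proof.
move=> theta_u le_rss; rewrite /excess_bound.
set w := fun e => y e - theta e.
pose a e := class_mean P c w (c e); pose r e := class_bias P theta c e.
have meany e : class_mean P c y (c e) = a e + r e + theta e.
  rewrite /a /r /class_bias addrA subrK -class_meanD; congr class_mean.
  by apply: funext => i; rewrite /w subrK.
have aw : \sum_(e | P e) a e * w e = \sum_(e | P e) a e ^+ 2.
  rewrite [RHS](sum_class_mean_mul P c w (class_mean P c w)).
  by apply: eq_bigr => e _; rewrite mulrC.
have ar : \sum_(e | P e) a e * r e = 0.
  apply/eqP; rewrite (eq_bigr (fun e => class_mean P c theta (c e) * a e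
    - theta e * a e)) => [|e _]; last by rewrite mulrC /r /class_bias mulrBl.
  rewrite sumrB; apply/eqP.
  by rewrite (sum_class_mean_mul P c theta (class_mean P c w)) subrr.
have rss_c : residual_sum_squares P y c = \sum_(e | P e) w e ^+ 2
    - \sum_(e | P e) a e ^+ 2 + \sum_(e | P e) r e ^+ 2
    - 2 * \sum_(e | P e) r e * w e.
  transitivity (\sum_(e | P e) w e ^+ 2 + \sum_(e | P e) a e ^+ 2
    + \sum_(e | P e) r e ^+ 2 + (- 2) * \sum_(e | P e) a e * w e
    + (- 2) * \sum_(e | P e) r e * w e + 2 * \sum_(e | P e) a e * r e).
    rewrite !mulr_sumr -!big_split; apply: eq_bigr => e _.
    by rewrite meany /w /=; ring.
  by rewrite aw ar; ring.
have rss_c0 : residual_sum_squares P y c0 <= \sum_(e | P e) w e ^+ 2.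
  pose d b := class_mean P c0 y b - u b.
  have cross : \sum_(e | P e) (y e - class_mean P c0 y (c0 e)) * d (c0 e) = 0.
    under eq_bigr => e _ do rewrite mulrBl.
    by rewrite sumrB sum_class_mean_mul subrr.
  suff -> : \sum_(e | P e) w e ^+ 2 = residual_sum_squares P y c0
      + \sum_(e | P e) d (c0 e) ^+ 2.
    by rewrite lerDl sumr_ge0 // => e _; rewrite sqr_ge0.
  transitivity (residual_sum_squares P y c0 + \sum_(e | P e) d (c0 e) ^+ 2 +
      2 * \sum_(e | P e) (y e - class_mean P c0 y (c0 e)) * d (c0 e)).
    rewrite mulr_sumr -!big_split; apply: eq_bigr => e Pe.
    by rewrite /w /d theta_u //=; ring.
  by rewrite cross mulr0 addr0.
have -> : \sum_(e | P e) (class_mean P c y (c e) - theta e) ^+ 2 =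
    \sum_(e | P e) a e ^+ 2 + \sum_(e | P e) r e ^+ 2.
  transitivity (\sum_(e | P e) a e ^+ 2 + \sum_(e | P e) r e ^+ 2 +
      2 * \sum_(e | P e) a e * r e); last by rewrite ar mulr0 addr0.
  rewrite mulr_sumr -!big_split; apply: eq_bigr => e _.
  by rewrite meany /=; ring.
rewrite -/a -/r; lra.
Qed.

(** * Exponential moments of the projected noise *)

Lemma expR_Nquarter_le (R : realType) : expR (- (1 / 4)) <= 4 / 5 :> R.
Proof.
have h : 5 / 4 <= expR (1 / 4) :> R by apply: le_trans (expR_ge1Dx _); lra.
by rewrite expRN -[(expR _)^-1]div1r ler_pdivrMr ?expR_gt0 //; lra.
Qed.

Lemma expR_half_le (R : realType) : expR (1 / 2) <= 2 :> R.
Proof.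
have h := expR_ge1Dx (- (1 / 2) : R); have gt0 := expR_gt0 (1 / 2 : R).
by rewrite expRN -[(expR _)^-1]div1r ler_pdivlMr // in h; lra.
Qed.

(** An exponential of a square is bounded by a finite mixture of exponentials of
    linear functions: after completing the square, the term whose index is the
    integer part of [x] alone exceeds the left side up to the factor 2. *)
Lemma expR_half_sqr_le (R : realType) (L : nat) (x : R) : `|x| <= L%:R ->
  expR (x ^+ 2 / 2) <=
  \sum_(m < L.*2.+1) 2 * expR ((m%:R - L%:R) * x - (m%:R - L%:R) ^+ 2 / 2).
Proof.
rewrite ler_norml => /andP[x_ge x_le].
have xL0 : 0 <= x + L%:R by lra.
have /andP[m_le m_gt] := truncn_itv xL0; set m := Num.truncn _ in m_le m_gt.
have mL : (m < L.*2.+1)%N.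
  rewrite ltnS -(ler_nat R) (le_trans m_le) // -addnn natrD; lra.
set d : R := m%:R - L%:R.
apply: le_trans (_ : 2 * expR (d * x - d ^+ 2 / 2) <= _); last first.
  rewrite (bigD1 (Ordinal mL)) //= lerDl.
  by apply: sumr_ge0 => i _; rewrite mulr_ge0 // expR_ge0.
have -> : x ^+ 2 / 2 = (d * x - d ^+ 2 / 2) + (x - d) ^+ 2 / 2 by field.
rewrite expRD mulrC ler_wpM2r ?expR_ge0 // (le_trans _ (expR_half_le R)) //.
rewrite ler_expR ler_pM2r ?invr_gt0 // expr_le1 // /d; last by lra.
by rewrite -natr1 in m_gt; lra.
Qed.

Lemma sum_expR_quarter_sqr_le (R : realType) (L : nat) :
  \sum_(m < L.*2.+1) expR (- ((m%:R - L%:R) ^+ 2 / 4)) <= 9 :> R.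
Proof.
suff : \sum_(m < L.*2.+1) expR (- ((m%:R - L%:R) ^+ 2 / 4))
    <= 9 - 8 * (4 / 5) ^+ L :> R.
  by move/le_trans; apply; rewrite gerBl mulr_ge0 // exprn_ge0.
elim: L => [|L IH].
  by rewrite big_ord1 subrr expr0n mul0r oppr0 expR0 expr0; lra.
have tail : expR (- (L.+1%:R ^+ 2 / 4)) <= (4 / 5) ^+ L.+1 :> R.
  apply: le_trans (_ : expR (L.+1%:R * (- (1 / 4))) <= _).
    rewrite ler_expR; have : 1 <= L.+1%:R :> R by rewrite ler1n.
    nra.
  by rewrite expRM_natl lerXn2r ?nnegrE ?expR_ge0 ?expR_Nquarter_le.
rewrite doubleS big_ord_recl big_ord_recr /= /bump /=.
have -> : (0%:R - L.+1%:R) ^+ 2 = L.+1%:R ^+ 2 :> R by ring.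
have -> : (1 + L.*2.+1)%:R - L.+1%:R = L.+1%:R :> R.
  have -> : (1 + L.*2.+1 = L.+1 + L.+1)%N by lia.
  by rewrite natrD addrK.
under eq_bigr => i _.
  have -> : (1 + i)%:R - L.+1%:R = i%:R - L%:R :> R.
    by rewrite natrD -[L.+1]addn1 natrD; ring.
  over.
rewrite (exprS (4 / 5)) in tail *; lra.
Qed.

Lemma norm_noise_le1 (R : realType) n (theta : 'M[R]_n) A e :
  edge_probabilities theta -> below e -> `|noise theta A e| <= 1.
Proof.
move=> th01 /th01; rewrite /noise ler_norml => /andP[? ?].
by case: (A _ _) => /=; lra.
Qed.

(** The square is linearized block by block, so that after expanding the product
    over the blocks a single linear functional of the noise is left for each choice
    [f] of mixture indices.  Its coefficients are the sum of a block-constant part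
    and of a multiple of the bias, which are orthogonal; the sub-Gaussian bound
    therefore splits into a part absorbed by the Gaussian weights of the mixture
    and a part absorbed by the negative square of the bias. *)
Lemma expectation_expR_excess (R : realType) n (theta : 'M[R]_n)
    (K : finType) (c : 'I_n * 'I_n -> K) : edge_probabilities theta ->
  expectation_under theta (fun A => expR (excess_bound below
    (fun e => theta e.1 e.2) (noise theta A) c / 24)) <= 18 ^+ #|K|.
Proof.
move=> th01; rewrite /excess_bound.
set r := class_bias _ _ c; set r2 := \sum_(e | below e) r e ^+ 2.
pose N b : R := (class_size below c b)%:R; pose s b : R := Num.sqrt (N b).
have N0 b : 0 <= N b by exact: ler0n.
have s2 b : s b ^+ 2 = N b by rewrite sqr_sqrtr.
have s0 b : 0 <= s b by exact: sqrtr_ge0.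
have Ns b : N b / s b = s b.
  rewrite -s2 expr2; have [->|s_neq0] := eqVneq (s b) 0; first by rewrite !mul0r.
  by rewrite mulfK.
pose w A b : R := class_mean below c (noise theta A) b.
pose x A b : R := s b * w A b / 2.
pose L := #|{: 'I_n * 'I_n}|.
have xL A b : `|x A b| <= L%:R.
  have w1 : `|w A b| <= 1.
    by apply: norm_class_mean_le1 => e; exact: norm_noise_le1.
  have NL : N b <= L%:R by rewrite ler_nat max_card.
  have sN : s b <= N b.
    rewrite -s2 /s /N; case: (class_size _ _ _) => [|k].
      by rewrite sqrtr0 expr0n.
    by rewrite expr2 ler_peMl ?sqrtr_ge0 // -[leLHS]sqrtr1 ler_wsqrtr // ler1n.
  rewrite /x normrM [`|s b * _|]normrM (ger0_norm (s0 b)) (@ger0_norm _ 2^-1) //.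
  have : s b * `|w A b| <= s b by rewrite ler_piMr.
  have := s0 b; lra.
pose M := L.*2.+1; pose d (m : 'I_M) : R := m%:R - L%:R.
(* The coefficients of the linear functional of the noise attached to f. *)
pose t (f : {ffun K -> 'I_M}) e := d (f (c e)) / (2 * s (c e)) + r e / 6.
pose cst (f : {ffun K -> 'I_M}) := \sum_b d (f b) ^+ 2 / 2 + r2 / 24.
have linear (f : {ffun K -> 'I_M}) A : \sum_b d (f b) * x A b +
    (\sum_(e | below e) r e * noise theta A e) / 6 =
    \sum_(e | below e) t f e * noise theta A e.
  under [RHS]eq_bigr => e _ do rewrite mulrDl.
  rewrite big_split /=; congr (_ + _); last first.
    by rewrite mulr_suml; apply: eq_bigr => e _; rewrite mulrAC.
  under [RHS]eq_bigr => e _ do rewrite mulrC.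
  rewrite -(sum_class_mean_mul below c (noise theta A)
    (fun b => d (f b) / (2 * s b))).
  rewrite (sum_by_class below c
    (fun b => class_mean below c (noise theta A) b * (d (f b) / (2 * s b)))).
  apply: eq_bigr => b _; rewrite /x -{1}Ns -/(w A b) -/(N b) invfM; ring.
have sum_t2 (f : {ffun K -> 'I_M}) : \sum_(e | below e) t f e ^+ 2 <=
    \sum_b d (f b) ^+ 2 / 4 + r2 / 36.
  have cross : \sum_(e | below e) r e * (d (f (c e)) / (2 * s (c e))) = 0.
    under eq_bigr => e _ do rewrite mulrBl.
    rewrite sumrB (sum_class_mean_mul below c (fun e => theta e.1 e.2)
      (fun b => d (f b) / (2 * s b))).
    by rewrite subrr.
  have -> : \sum_(e | below e) t f e ^+ 2 =
      \sum_b N b * (d (f b) / (2 * s b)) ^+ 2 + r2 / 36.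
    rewrite -(sum_by_class below c (fun b => (d (f b) / (2 * s b)) ^+ 2)).
    transitivity (\sum_(e | below e) (d (f (c e)) / (2 * s (c e))) ^+ 2 +
       r2 / 36 + 1 / 3 * \sum_(e | below e) r e * (d (f (c e)) / (2 * s (c e)))).
      rewrite mulr_suml mulr_sumr -!big_split; apply: eq_bigr => e _.
      by rewrite /t /=; set u := d _ / _; field.
    by rewrite cross mulr0 addr0.
  rewrite lerD2r; apply: ler_sum => b _.
  have -> : N b * (d (f b) / (2 * s b)) ^+ 2 =
      d (f b) ^+ 2 / 4 * (N b / s b / s b).
    by rewrite invfM; move: (s b)^-1 => si; field.
  rewrite Ns ler_piMr ?(mulr_ge0 (sqr_ge0 _)) //.
  by have [->|s_neq0] := eqVneq (s b) 0; rewrite ?mul0r ?divff.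
have step A : expR ((3 * \sum_(e | below e) class_mean below c
      (noise theta A) (c e) ^+ 2 +
      4 * \sum_(e | below e) r e * noise theta A e - r2) / 24) <=
    \sum_(f : {ffun K -> 'I_M}) 2 ^+ #|K| * expR (- cst f) *
      expR (\sum_(e | below e) t f e * noise theta A e).
  rewrite (sum_by_class below c
    (fun b => class_mean below c (noise theta A) b ^+ 2)) -/(w A _).
  have -> : (3 * \sum_b N b * w A b ^+ 2 +
      4 * \sum_(e | below e) r e * noise theta A e - r2) / 24 =
      \sum_b x A b ^+ 2 / 2 +
      ((\sum_(e | below e) r e * noise theta A e) / 6 - r2 / 24).
    have -> : \sum_b x A b ^+ 2 / 2 = (\sum_b N b * w A b ^+ 2) / 8.
      by rewrite mulr_suml; apply: eq_bigr => b _; rewrite -s2 /x; field.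
    by field.
  rewrite expRD expR_sum; set z := expR (_ / 6 - _).
  apply: le_trans (_ : \prod_b (\sum_(m < M)
      2 * expR (d m * x A b - d m ^+ 2 / 2)) * z <= _).
    rewrite ler_wpM2r ?expR_ge0 //; apply: ler_prod => b _.
    by rewrite expR_ge0 expR_half_sqr_le.
  rewrite bigA_distr_bigA mulr_suml; apply: ler_sum => f _.
  rewrite big_split /= prodr_const -expR_sum -!mulrA -!expRD.
  rewrite ler_wpM2l ?exprn_ge0 // ler_expR -linear sumrB /cst; lra.
apply: le_trans (_ : expectation_under theta (fun A =>
    \sum_(f : {ffun K -> 'I_M}) 2 ^+ #|K| * expR (- cst f) *
      expR (\sum_(e | below e) t f e * noise theta A e)) <= _).
  exact: expectation_under_le.
rewrite expectation_under_sum.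
under eq_bigr => f _ do rewrite expectation_underZ.
apply: le_trans (_ : \sum_(f : {ffun K -> 'I_M})
    \prod_b (2 * expR (- (d (f b) ^+ 2 / 4))) <= _); last first.
  rewrite -(bigA_distr_bigA (fun _ m => 2 * expR (- (d m ^+ 2 / 4)))).
  rewrite -prodr_const; apply: ler_prod => b _.
  rewrite -mulr_sumr; apply/andP; split.
    by rewrite mulr_ge0 // sumr_ge0 // => m _; exact: expR_ge0.
  have -> : 18 = 2 * 9 :> R by rewrite -natrM.
  by rewrite ler_wpM2l // sum_expR_quarter_sqr_le.
apply: ler_sum => f _.
apply: le_trans (_ : 2 ^+ #|K| * expR (- cst f) *
    expR (\sum_(e | below e) t f e ^+ 2) <= _).
  rewrite ler_wpM2l ?mulr_ge0 ?exprn_ge0 ?expR_ge0 //.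
  exact: expectation_expR_noise.
rewrite big_split /= prodr_const -expR_sum -mulrA -expRD.
rewrite ler_wpM2l ?exprn_ge0 // ler_expR.
have r2_ge0 : 0 <= r2 by apply: sumr_ge0 => e _; exact: sqr_ge0.
have := sum_t2 f; rewrite /cst sumrN.
have -> : \sum_b d (f b) ^+ 2 / 2 = 2 * \sum_b d (f b) ^+ 2 / 4.
  by rewrite mulr_sumr; apply: eq_bigr => b _; field.
lra.
Qed.

(** The union bound in exponential form; subtracting the logarithm [l] of the
    normalising factor first turns [x <= expR x - 1] into a bound without
    additive constant. *)
Lemma expectation_max_le (R : realType) n (theta : 'M[R]_n) (Z : finType)
    (G : Z -> 'M[bool]_n -> R) (X : 'M[bool]_n -> R) (B a : R) :
  edge_probabilities theta -> 0 < a -> 0 < B -> (0 < #|Z|)%N ->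
  (forall A, exists z, X A <= G z A) ->
  (forall z, expectation_under theta (fun A => expR (G z A / a)) <= B) ->
  expectation_under theta X <= a * ln (#|Z|%:R * B).
Proof.
move=> th01 a_gt0 B_gt0 Z_gt0 XG GB.
have ZB_gt0 : 0 < #|Z|%:R * B by rewrite mulr_gt0 ?ltr0n.
set l := ln _.
have expRl : expR l = #|Z|%:R * B by rewrite lnK // posrE.
apply: le_trans (_ : expectation_under theta (fun A =>
   a * (l - 1) + \sum_z (a / expR l) * expR (G z A / a)) <= _).
  apply: expectation_under_le => // A; have [z Xz] := XG A.
  apply: le_trans Xz _; rewrite (bigD1 z) //= addrA.
  apply: le_trans (_ : a * (l - 1) + a / expR l * expR (G z A / a) <= _).
    have := expR_ge1Dx (G z A / a - l); rewrite expRD expRN => h.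
    have -> : G z A = a * (G z A / a) by field; rewrite gt_eqF.
    rewrite -mulrA -mulrDr (ler_pM2l a_gt0) [a * _]mulrC mulfK ?gt_eqF //; lra.
  rewrite lerDl sumr_ge0 // => y _.
  by rewrite mulr_ge0 ?divr_ge0 ?expR_ge0 // ltW.
rewrite expectation_underD expectation_under_cst expectation_under_sum.
under eq_bigr => z _ do rewrite expectation_underZ.
rewrite -mulr_sumr.
have : \sum_z expectation_under theta (fun A => expR (G z A / a)) <= expR l.
  rewrite expRl mulr_natl -sumr_const; exact: ler_sum.
rewrite -(ler_pM2l (_ : 0 < a / expR l)) ?divr_gt0 ?expR_gt0 //.
rewrite mulfVK ?gt_eqF ?expR_gt0 //.
lra.
Qed.

(** * The upper bound *)

Lemma sum_pairs (R : realType) n (f : 'I_n -> 'I_n -> R) :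
  \sum_i \sum_j f i j = \sum_(e | below e) f e.1 e.2 +
    \sum_(e | below e) f e.2 e.1 + \sum_i f i i.
Proof.
have lowE (g : 'I_n -> 'I_n -> R) : \sum_(e | below e) g e.1 e.2 =
    \sum_(i < n) \sum_(j < n | (j < i)%N) g i j by rewrite pair_big_dep.
rewrite (lowE f) (lowE (fun i j => f j i)).
rewrite [X in _ + X + _](exchange_big_dep xpredT) //= -!big_split.
apply: eq_bigr => i _.
rewrite (bigID (fun j : 'I_n => (j < i)%N)) /= -addrA; congr (_ + _).
rewrite (bigD1 i) ?ltnn //= addrC; congr (_ + _); apply: eq_bigl => j.
by rewrite -leqNgt -val_eqE /=; case: ltngtP.
Qed.

Lemma mse_ge_below (R : realType) n (M theta : 'M[R]_n) :
  (n%:R ^+ 2)^-1 * \sum_(e | below e) (M e.1 e.2 - theta e.1 e.2) ^+ 2 <=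
  mse M theta.
Proof.
rewrite /mse ler_wpM2l ?invr_ge0 ?sqr_ge0 // sum_pairs -addrA lerDl.
by rewrite addr_ge0 // sumr_ge0 // => *; rewrite sqr_ge0.
Qed.

Definition symmetric_fill {R : realType} {n} (m : 'I_n * 'I_n -> R) : 'M[R]_n :=
  \matrix_(i, j) if (j < i)%N then m (i, j)
                 else if (i < j)%N then m (j, i) else 0.

Lemma mse_symmetric_fill (R : realType) n (m : 'I_n * 'I_n -> R)
    (theta : 'M[R]_n) :
  (forall i j, theta i j = theta j i) -> (forall i, theta i i = 0) ->
  mse (symmetric_fill m) theta =
  2 / n%:R ^+ 2 * \sum_(e | below e) (m e - theta e.1 e.2) ^+ 2.
Proof.
move=> th_sym th0; rewrite /mse sum_pairs.
rewrite [X in _ + X]big1 => [|i _]; last first.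
  by rewrite mxE ltnn th0 subrr expr0n.
rewrite addr0 [2 / _]mulrC -mulrA; congr (_ * _).
rewrite mulr_natl mulr2n; congr (_ + _); apply: eq_bigr => -[i j] /=;
  rewrite /below /= mxE => ij.
  by rewrite ij.
by rewrite ij ltnNge (ltnW ij) /= th_sym.
Qed.

(** Ordered pairs of labels are used as classes, although the true matrix [Q] is
    symmetric: the extra freedom costs only a factor 2 in the number of classes. *)
Definition edge_class {n k} (z : {ffun 'I_n -> 'I_k}) (e : 'I_n * 'I_n) :
  'I_k * 'I_k := (z e.1, z e.2).

Definition least_squares_labels (R : realType) n k
    (A : 'M[bool]_n) : {ffun 'I_n -> 'I_k.+1} :=
  [arg min_(z < [ffun=> ord0])
    residual_sum_squares (R := R) below (fun e => (A e.1 e.2)%:R)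
      (edge_class z)]%O.

Definition least_squares_estimator (R : realType) n k : estimator R n :=
  fun A => symmetric_fill (fun e => class_mean below
    (edge_class (least_squares_labels R k A)) (fun e => (A e.1 e.2)%:R)
    (edge_class (least_squares_labels R k A) e)).

Lemma sbm_space_edge_probabilities (R : realType) n k (theta : 'M[R]_n) :
  sbm_space R n k theta -> edge_probabilities theta.
Proof.
case=> Q [z [Q01 _ _ thQ]] [i j]; rewrite /below /= => ij.
by rewrite thQ // -val_eqE /= gtn_eqF.
Qed.

Lemma least_squares_risk (R : realType) n k (theta : 'M[R]_n) :
  sbm_space R n k.+1 theta ->
  expectation_under theta
    (fun A => mse (least_squares_estimator R k A) theta) <=
  2 / n%:R ^+ 2 * (24 * ln (((k.+1 ^ n)%N)%:R * 18 ^+ (k.+1 * k.+1))).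
Proof.
move=> th_sbm; have th01 := sbm_space_edge_probabilities th_sbm.
case: th_sbm => Q [z [Q01 Qsym th0 thQ]].
have th_sym i j : theta i j = theta j i.
  by have [->//|ij] := eqVneq i j; rewrite !thQ // 1?eq_sym.
under [X in expectation_under _ X]funext => A.
  rewrite /least_squares_estimator mse_symmetric_fill //; over.
rewrite expectation_underZ ler_wpM2l ?divr_ge0 ?sqr_ge0 //.
have cardZ : #|{: {ffun 'I_n -> 'I_k.+1}}| = (k.+1 ^ n)%N.
  by rewrite card_ffun !card_ord.
rewrite -cardZ.
apply: (expectation_max_le (G := fun (c : {ffun 'I_n -> 'I_k.+1}) A =>
  excess_bound below (fun e => theta e.1 e.2) (noise theta A)
    (edge_class c))) => //.
- by rewrite cardZ expn_gt0.
- move=> A; exists (least_squares_labels R k A).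
  apply: (least_squares_oracle (c0 := edge_class [ffun i => z i])
    (u := fun ab => Q ab.1 ab.2)) => [[i j]|].
    by rewrite /below /= => ij; rewrite !ffunE thQ // -val_eqE /= gtn_eqF.
  by rewrite /least_squares_labels; case: arg_minP => // c _ /(_ [ffun i => z i]); exact.
- move=> c; have := expectation_expR_excess (edge_class c) th01.
  by rewrite card_prod card_ord.
Qed.

(** The logarithm of [k ^ n] gives the clustering rate, and the exponential moment
    of the [k * k] blocks the parametric one. *)
Lemma minimax_risk_upper (R : realType) n k : (1 <= k <= n)%N ->
  (minimax_risk (sbm_space R n k) <= (864 * sbm_rate R n k)%:E)%E.
Proof.
case: k => [//|k] /andP[_ kn].
have n_gt0 : 0 < n%:R :> R by rewrite ltr0n (leq_trans _ kn).
apply: ge_ereal_inf.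
eexists; first by exists (least_squares_estimator R k).
apply: ge_ereal_sup => _ [theta th_sbm <-]; rewrite lee_fin.
apply: le_trans (least_squares_risk th_sbm) _.
have k_gt0 : 0 < k.+1%:R :> R by rewrite ltr0n.
rewrite lnM ?posrE ?exprn_gt0 ?ltr0n ?expn_gt0 // natrX !lnXn //.
have ln18 : ln 18 <= 18 :> R by rewrite ltW // ln_sublinear.
have lnk : 0 <= ln k.+1%:R :> R by rewrite ln_ge0 // ler1n.
rewrite -[ln k.+1%:R *+ _]mulr_natl -[ln 18 *+ _]mulr_natl natrM /sbm_rate.
rewrite [leRHS](_ : _ = 2 / n%:R ^+ 2 *
    (24 * (n%:R * ln k.+1%:R + k.+1%:R * k.+1%:R * 18)) +
    816 * (n%:R / n%:R ^+ 2 * ln k.+1%:R)); last first.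
  by field; rewrite gt_eqF.
apply: ler_wpDr.
  apply: mulr_ge0; first exact: ler0n.
  by apply: mulr_ge0 lnk; rewrite divr_ge0 ?sqr_ge0 ?ler0n.
apply: ler_wpM2l; first by rewrite divr_ge0 ?sqr_ge0 ?ler0n.
apply: ler_wpM2l; first exact: ler0n.
rewrite lerD2l; apply: ler_wpM2l ln18.
by rewrite mulr_ge0 ?ler0n.
Qed.

(** * Testing many hypotheses coordinate by coordinate *)

Definition interior {R : realType} {n} (q : 'M[R]_n) : Prop :=
  forall e, below e -> 0 < q e.1 e.2 < 1.

Lemma graph_pmf_gt0 (R : realType) n (q : 'M[R]_n) A :
  interior q -> simple_graph A -> 0 < graph_pmf q A.
Proof.
move=> q01 sA; rewrite graph_pmfE sA; apply: prodr_gt0 => e /q01 /andP[? ?].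
by rewrite /bernoulli_pmf; case: ifP => // _; rewrite subr_gt0.
Qed.

Lemma sum_graph_pmf_sqr_div (R : realType) n (p q : 'M[R]_n) :
  \sum_A graph_pmf p A ^+ 2 / graph_pmf q A = \prod_(e | below e)
    (p e.1 e.2 ^+ 2 / q e.1 e.2 + (1 - p e.1 e.2) ^+ 2 / (1 - q e.1 e.2)).
Proof.
rewrite -(sum_simple_graph_prod (fun e b =>
  bernoulli_pmf (p e.1 e.2) b ^+ 2 / bernoulli_pmf (q e.1 e.2) b)).
rewrite [RHS]big_mkcond; apply: eq_bigr => A _; rewrite !graph_pmfE.
by case: ifP => _; rewrite ?expr0n ?mul0r // big_split /= prodrXl prodfV.
Qed.

(** The chi-square divergence tensorizes; around a fair coin each edge contributes
    the factor [1 + 4 d ^ 2], [d] being the deviation. *)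
Lemma chi_square_le (R : realType) n (p q : 'M[R]_n) :
  interior q ->
  (forall e, below e -> p e.1 e.2 = q e.1 e.2 \/ q e.1 e.2 = 1 / 2) ->
  \sum_A graph_pmf p A ^+ 2 / graph_pmf q A <=
  expR (4 * \sum_(e | below e) (p e.1 e.2 - q e.1 e.2) ^+ 2).
Proof.
move=> q01 pq; rewrite sum_graph_pmf_sqr_div mulr_sumr expR_sum.
apply: ler_prod => e be; have /andP[q0 q1] := q01 e be.
rewrite addr_ge0 ?divr_ge0 ?sqr_ge0 ?subr_ge0 ?(ltW q0) ?(ltW q1) //=.
apply: le_trans (expR_ge1Dx _).
case: (pq e be) => [->|->].
  by rewrite subrr expr0n mulr0 addr0 !expr2 !mulfK ?gt_eqF ?subr_gt0 // subrKC.
have -> : 1 - 1 / 2 = 1 / 2 :> R by field.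
by rewrite invf_div divr1; lra.
Qed.

(** Testing [M] hypotheses with a common reference law.  Whatever the data, at most
    one hypothesis is closer to the estimate than half the separating distance, and
    [2 * x <= x ^+ 2 / (M * y) + M * y] bounds the likelihood of that one by the
    reference law and the sum of the chi-square densities of all of them; summing
    over the data, the true hypothesis, when it is uniformly distributed, is
    missed with probability at least 1/8. *)
Lemma testing_lower_bound (R : realType) n M (p : 'I_M -> 'M[R]_n)
    (q : 'M[R]_n) (D : pred ('I_n * 'I_n)) (Delta : R)
    (m : 'M[bool]_n -> 'I_n * 'I_n -> R) :
  (0 < M)%N -> 0 <= Delta ->
  (forall a, edge_probabilities (p a)) -> interior q ->
  (forall a, \sum_A graph_pmf (p a) A ^+ 2 / graph_pmf q A <= 3 / 4 * M%:R) ->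
  (forall a b, a != b ->
    Delta <= \sum_(e | D e) (p a e.1 e.2 - p b e.1 e.2) ^+ 2) ->
  M%:R * (Delta / 32) <= \sum_a expectation_under (p a)
    (fun A => \sum_(e | D e) (m A e - p a e.1 e.2) ^+ 2).
Proof.
move=> M_gt0 Delta_ge0 p01 q01 chi sep.
pose loss a A := \sum_(e | D e) (m A e - p a e.1 e.2) ^+ 2.
pose chi_sum A := \sum_a graph_pmf (p a) A ^+ 2 / graph_pmf q A.
have MR : 0 < M%:R :> R by rewrite ltr0n.
have q_ge0 A : 0 <= graph_pmf q A.
  by apply: graph_pmf_ge0 => e /q01/andP[q0 q1]; rewrite !ltW.
have chi_sum_ge0 A : 0 <= chi_sum A.
  by apply: sumr_ge0 => a _; rewrite divr_ge0 ?sqr_ge0.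
have pointwise A : Delta / 4 * (\sum_a graph_pmf (p a) A -
    (chi_sum A / (2 * M%:R) + M%:R / 2 * graph_pmf q A)) <=
    \sum_a graph_pmf (p a) A * loss a A.
  case: (arg_minP (P := xpredT) (fun a => loss a A) (i0 := Ordinal M_gt0)) => // b _ bmin.
  have far a : a != b -> Delta / 4 <= loss a A.
    move=> /sep/le_trans sep_ab.
    have : Delta <= 2 * loss a A + 2 * loss b A.
      apply: sep_ab; rewrite /loss !mulr_sumr -big_split /=.
      apply: ler_sum => e _.
      have := sqr_ge0 (m A e - p a e.1 e.2 + (m A e - p b e.1 e.2)); lra.
    by have := bmin a isT; lra.
  have closest : graph_pmf (p b) A <=
      chi_sum A / (2 * M%:R) + M%:R / 2 * graph_pmf q A.
    have [sA|nsA] := boolP (simple_graph A); last first.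
      have pmf0 th : graph_pmf th A = 0 :> R by rewrite graph_pmfE (negbTE nsA).
      by rewrite pmf0 addr_ge0 // ?divr_ge0 ?mulr_ge0 ?ler0n.
    have q_gt0 := graph_pmf_gt0 q01 sA.
    apply: le_trans (_ : graph_pmf (p b) A ^+ 2 / graph_pmf q A / (2 * M%:R) +
        M%:R / 2 * graph_pmf q A <= _).
      rewrite -subr_ge0.
      have -> : graph_pmf (p b) A ^+ 2 / graph_pmf q A / (2 * M%:R) +
          M%:R / 2 * graph_pmf q A - graph_pmf (p b) A =
          (graph_pmf (p b) A - M%:R * graph_pmf q A) ^+ 2 /
          (graph_pmf q A * (2 * M%:R)).
        by field; rewrite !gt_eqF.
      by rewrite divr_ge0 ?sqr_ge0 // ltW // !mulr_gt0.
    rewrite lerD2r ler_wpM2r ?invr_ge0 ?mulr_ge0 // ?(ltW MR) //.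
    rewrite /chi_sum (bigD1 b) //= lerDl sumr_ge0 // => a _.
    by rewrite divr_ge0 ?sqr_ge0 // ltW.
  apply: le_trans (_ : Delta / 4 * (\sum_a graph_pmf (p a) A -
      graph_pmf (p b) A) <= _).
    by rewrite ler_wpM2l ?divr_ge0 // lerD2l lerN2.
  rewrite (bigD1 b) //= addrAC subrr add0r mulr_sumr.
  rewrite [leRHS](bigD1 b) //= -[leLHS]add0r lerD //.
    by rewrite mulr_ge0 ?graph_pmf_ge0 // sumr_ge0 // => e _; exact: sqr_ge0.
  by apply: ler_sum => a /far ?; rewrite mulrC ler_wpM2l ?graph_pmf_ge0.
have -> : \sum_a expectation_under (p a) (loss a) =
    \sum_A \sum_a graph_pmf (p a) A * loss a A by rewrite exchange_big.
apply: le_trans (ler_sum _ (fun A _ => pointwise A)).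
rewrite -mulr_sumr sumrB big_split /= -mulr_suml -mulr_sumr sum_graph_pmf.
rewrite exchange_big [X in _ * (_ - (X / _ + _))]exchange_big /=.
under eq_bigr => a _ do rewrite sum_graph_pmf.
rewrite sumr_const card_ord.
set S := \sum_(a < M) _.
have S_le : S <= M%:R * (3 / 4 * M%:R).
  rewrite [leRHS](_ : _ = \sum_(a < M) 3 / 4 * M%:R).
    by apply: ler_sum => a _; exact: chi.
  by rewrite sumr_const card_ord mulr_natl.
have {}S_le : S / (2 * M%:R) <= 3 / 8 * M%:R.
  by rewrite ler_pdivrMr ?mulr_gt0 //; lra.
have -> : M%:R * (Delta / 32) = Delta / 4 * (M%:R - (3 / 8 * M%:R + M%:R / 2 * 1)).
  by field.
by rewrite ler_wpM2l ?divr_ge0 // lerD2l lerN2 lerD2r.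
Qed.

Definition set_coordinate {T : finType} {V : Type} (x : {ffun T -> V}) (t : T)
  (a : V) : {ffun T -> V} := [ffun s => if s == t then a else x s].

(** Swapping a free value with the current value at [t] is an involution, so
    resampling one coordinate leaves the uniform average unchanged. *)
Lemma sum_resample (R : realType) (T V : finType) (t : T)
    (F : {ffun T -> V} -> R) :
  \sum_x \sum_a F (set_coordinate x t a) = #|V|%:R * \sum_x F x.
Proof.
rewrite pair_big /= mulr_natl -sumr_const exchange_big pair_big /=.
pose swap (xa : {ffun T -> V} * V) := (set_coordinate xa.1 t xa.2, xa.1 t).
have swapK : involutive swap.
  move=> [x a]; rewrite /swap /=; congr (_, _); last by rewrite ffunE eqxx.
  by apply/ffunP => s; rewrite !ffunE; case: eqP => // ->.
by rewrite [RHS](reindex_inj (inv_inj swapK)).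
Qed.

(** Assouad's lemma with [M]-ary coordinates.  Under the uniform prior on [x], the
    risk on the edges of class [t] is at least its value when all coordinates but
    [t] are revealed, which is a problem of testing [M] hypotheses; the classes are
    disjoint, so these risks add up.  The reference law may depend on the revealed
    coordinates. *)
Lemma multiary_assouad (R : realType) n M (T : finType) (P : pred T)
    (c : 'I_n * 'I_n -> T) (theta : {ffun T -> 'I_M} -> 'M[R]_n) (Delta : R)
    (m : 'M[bool]_n -> 'I_n * 'I_n -> R) :
  (0 < M)%N -> 0 <= Delta -> (forall x, edge_probabilities (theta x)) ->
  (forall t x, P t -> exists2 q : 'M[R]_n, interior q & forall a,
    \sum_A graph_pmf (theta (set_coordinate x t a)) A ^+ 2 / graph_pmf q A
    <= 3 / 4 * M%:R) ->
  (forall t x a b, P t -> a != b ->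
    Delta <= \sum_(e | below e && (c e == t))
      (theta (set_coordinate x t a) e.1 e.2 -
       theta (set_coordinate x t b) e.1 e.2) ^+ 2) ->
  exists x, #|P|%:R * (Delta / 32) <= expectation_under (theta x)
    (fun A => \sum_(e | below e) (m A e - theta x e.1 e.2) ^+ 2).
Proof.
move=> M_gt0 Delta_ge0 th01 ref sep.
pose risk t x := expectation_under (theta x)
  (fun A => \sum_(e | below e && (c e == t)) (m A e - theta x e.1 e.2) ^+ 2).
have risk_ge0 t x : 0 <= risk t x.
  apply: sumr_ge0 => A _; rewrite mulr_ge0 ?graph_pmf_ge0 //.
  by apply: sumr_ge0 => e _; exact: sqr_ge0.
have riskE x : expectation_under (theta x)
    (fun A => \sum_(e | below e) (m A e - theta x e.1 e.2) ^+ 2) =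
    \sum_t risk t x.
  rewrite -expectation_under_sum; apply: eq_bigr => A _; congr (_ * _).
  exact: partition_big.
have MR : 0 < M%:R :> R by rewrite ltr0n.
pose X := {ffun T -> 'I_M}.
have avg t : P t -> #|{: X}|%:R * (Delta / 32) <= \sum_x risk t x.
  move=> Pt; have resample := sum_resample t (risk t).
  rewrite card_ord in resample; rewrite -(ler_pM2l MR) -resample.
  rewrite mulrCA [leLHS]mulr_natl -sumr_const; apply: ler_sum => x _.
  have [q q01 chi] := ref t x Pt.
  by apply: testing_lower_bound q01 chi _ => // a b; exact: sep.
pose x0 : X := [ffun=> Ordinal M_gt0].
suff : [exists x : X, #|P|%:R * (Delta / 32) <= \sum_t risk t x].
  by case/existsP => x; rewrite -riskE; exists x.
apply: contraT; rewrite negb_exists => /forallP small.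
have : \sum_(x : X) \sum_t risk t x < \sum_(x : X) #|P|%:R * (Delta / 32).
  apply: ltr_sum => [|x _]; last by rewrite ltNge.
  by apply/hasP; exists x0; rewrite ?mem_index_enum.
have -> : \sum_(x : X) #|P|%:R * (Delta / 32) =
    \sum_(t | P t) #|{: X}|%:R * (Delta / 32).
  by rewrite !sumr_const -[LHS]mulr_natl -[RHS]mulr_natl mulrCA.
rewrite ltNge => /negP[]; rewrite exchange_big [leRHS](bigID P) /=.
rewrite -[leLHS]addr0; apply: lerD; first by apply: ler_sum => t /avg.
by apply: sumr_ge0 => t _; apply: sumr_ge0.
Qed.

(** * The lower bound from the connection probabilities *)

Definition sbm_matrix {R : realType} {n k} (Q : 'M[R]_k) (z : 'I_n -> 'I_k) :
  'M[R]_n := \matrix_(i, j) if i == j then 0 else Q (z i) (z j).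

Lemma sbm_matrix_in_space (R : realType) n k (Q : 'M[R]_k) (z : 'I_n -> 'I_k) :
  (forall a b, 0 <= Q a b <= 1) -> (forall a b, Q a b = Q b a) ->
  sbm_space R n k (sbm_matrix Q z).
Proof.
move=> Q01 Qsym; exists Q, z; split=> // [i|i j /negbTE ij]; rewrite mxE ?eqxx //.
by rewrite ij.
Qed.

Lemma sbm_matrix_below (R : realType) n k (Q : 'M[R]_k) (z : 'I_n -> 'I_k) e :
  below e -> sbm_matrix Q z e.1 e.2 = Q (z e.1) (z e.2).
Proof. by rewrite /below mxE -val_eqE /= => e21; rewrite gtn_eqF. Qed.

Lemma minimax_risk_ge (R : realType) n k (r : R) :
  (forall that : estimator R n, exists2 theta, sbm_space R n k theta &
    r <= expectation_under theta
      (fun A => \sum_(e | below e) (that A e.1 e.2 - theta e.1 e.2) ^+ 2)) ->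
  (((n%:R ^+ 2)^-1 * r)%:E <= minimax_risk (sbm_space R n k))%E.
Proof.
move=> lower; apply: le_ereal_inf_tmp => _ [that _ <-].
have [theta th_sbm r_le] := lower that.
apply: le_trans (ereal_sup_ubound _); last by exists theta.
rewrite lee_fin.
apply: le_trans (_ : expectation_under theta (fun A => (n%:R ^+ 2)^-1 *
   \sum_(e | below e) (that A e.1 e.2 - theta e.1 e.2) ^+ 2) <= _).
  by rewrite expectation_underZ ler_wpM2l ?invr_ge0 ?sqr_ge0.
apply: expectation_under_le => [|A]; last exact: mse_ge_below.
exact: sbm_space_edge_probabilities th_sbm.
Qed.

Lemma expR_quarter_le (R : realType) : expR (1 / 4) <= 3 / 2 :> R.
Proof.
have h := expR_ge1Dx (- (1 / 4) : R); have gt0 := expR_gt0 (1 / 4 : R).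
by rewrite expRN -[(expR _)^-1]div1r ler_pdivlMr // in h; lra.
Qed.

(** The nodes [i <= k] get distinct labels, so that every block between two
    different labels is nonempty.  Labels are nondecreasing, so that edges below the
    diagonal that join the same two labels have the same ordered class. *)
Definition staircase_label {n} k (i : 'I_n) : 'I_k.+1 := inord (minn i k).

Lemma staircase_label_val n k (i : 'I_n) :
  staircase_label k i = minn i k :> nat.
Proof. by rewrite inordK // ltnS geq_minr. Qed.

Definition staircase_class {n} k (e : 'I_n * 'I_n) : 'I_k.+1 * 'I_k.+1 :=
  (staircase_label k e.1, staircase_label k e.2).

Definition block_size n k (t : 'I_k.+1 * 'I_k.+1) : nat :=
  class_size below (@staircase_class n k) t.

Lemma card_nonempty_blocks (R : realType) n k : (2 <= n)%N -> (k.+1 <= n)%N ->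
  k.+1%:R ^+ 2 / 4 <= #|[pred t | (0 < @block_size n k t)%N]|%:R :> R.
Proof.
move=> n2 kn.
have nonempty (e : 'I_n * 'I_n) :
    below e -> (0 < @block_size n k (staircase_class k e))%N.
  by move=> be; apply/card_gt0P; exists e; rewrite inE be eqxx.
case: k kn nonempty => [|k] kn nonempty.
  apply: le_trans (_ : 1%:R <= _); first by lra.
  rewrite ler_nat; apply/card_gt0P.
  exists (staircase_class 0 (Ordinal n2, Ordinal (ltnW n2))).
  by rewrite inE nonempty.
have count : \sum_(e : 'I_k.+2 * 'I_k.+2 | below e) 1 <=
    #|[pred t | (0 < @block_size n k.+1 t)%N]|%:R :> R.
  rewrite -sumr_const big_mkcond [leRHS]big_mkcond; apply: ler_sum => -[a b] _.
  rewrite inE; case: ifP => [ab|_]; last by case: ifP.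
  have lt_n (c : 'I_k.+2) : (c < n)%N by rewrite (leq_trans _ kn).
  have labK (c : 'I_k.+2) : staircase_label k.+1 (Ordinal (lt_n c)) = c.
    apply: val_inj; rewrite /= staircase_label_val /=.
    by apply/minn_idPl; rewrite -ltnS.
  have := nonempty (Ordinal (lt_n a), Ordinal (lt_n b)).
  by rewrite /staircase_class /= !labK => ->.
apply: le_trans count; have := sum_pairs (fun _ _ : 'I_k.+2 => 1 : R).
rewrite !sumr_const !card_ord -[_ *+ k.+2 *+ k.+2]mulr_natr.
set s := #|below|%:R => total.
have : 2 <= k.+2%:R :> R by rewrite ler_nat.
nra.
Qed.

(** One sign per nonempty block, and about [k ^ 2 / 2] of them: each sign
    contributes a constant to the squared error. *)
Lemma minimax_risk_ge_parametric (R : realType) n k :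
  (2 <= n)%N -> (1 <= k <= n)%N ->
  ((k%:R ^+ 2 / (512 * n%:R ^+ 2))%:E <= minimax_risk (sbm_space R n k))%E.
Proof.
case: k => [//|k] n2 /andP[_ kn].
pose N t : R := (@block_size n k t)%:R; pose s t : R := Num.sqrt (N t).
(* Moving each of the N t edges of block t by d t gives a total squared deviation
   of 1/16, small enough for the two signs to be confused. *)
pose d t : R := (4 * s t)^-1.
pose sg (a : 'I_2) : R := (-1) ^+ a.
have sg2 a : sg a ^+ 2 = 1 by rewrite -exprM mulnC exprM sqrrN expr1n expr1n.
have s0 t : 0 <= s t by exact: sqrtr_ge0.
have d0 t : 0 <= d t by rewrite invr_ge0 mulr_ge0.
have d_le t : d t <= 1 / 4.
  rewrite /d /s /N; case: (block_size _ _) => [|m].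
    by rewrite sqrtr0 mulr0 invr0.
  rewrite invfM mulrC ler_wpM2r // invf_le1 ?sqrtr_gt0 ?ltr0n //.
  by rewrite -[leLHS]sqrtr1 ler_wsqrtr // ler1n.
have Nd2 t : (0 < @block_size n k t)%N -> N t * d t ^+ 2 = 1 / 16.
  move=> Nt; have Ngt0 : 0 < N t by rewrite ltr0n.
  rewrite exprVn exprMn sqr_sqrtr ?ltW //; field.
  by rewrite gt_eqF.
pose ord2 (a b : 'I_k.+1) := if (b <= a)%N then (a, b) else (b, a).
pose Q (x : {ffun 'I_k.+1 * 'I_k.+1 -> 'I_2}) : 'M[R]_k.+1 :=
  \matrix_(a, b) (1 / 2 + d (ord2 a b) * sg (x (ord2 a b))).
pose theta x : 'M[R]_n := sbm_matrix (Q x) (staircase_label k).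
have thetaE x e : below e -> theta x e.1 e.2 =
    1 / 2 + d (staircase_class k e) * sg (x (staircase_class k e)).
  move=> be; rewrite /theta sbm_matrix_below // mxE /ord2 ifT //.
  by rewrite !staircase_label_val leq_min geq_minr andbT geq_min (ltnW be).
have Q_itv x a b : 1 / 4 <= Q x a b <= 3 / 4.
  rewrite mxE; set t := ord2 a b; have := d_le t; have := d0 t.
  by rewrite /sg; case: (x t) => -[|[|//]] ? /=; rewrite ?expr1 ?expr0; lra.
have th_sbm x : sbm_space R n k.+1 (theta x).
  apply: sbm_matrix_in_space => [a b|a b]; first by have := Q_itv x a b; lra.
  rewrite !mxE /ord2; case: ltngtP => // /val_inj -> //.
apply: le_trans (_ : (((n%:R ^+ 2)^-1 * (k.+1%:R ^+ 2 / 4 * (1 / 4 / 32)))%:E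
    <= _)%E); first by rewrite lee_fin le_eqVlt; apply/orP; left; apply/eqP; field;
    rewrite pnatr_eq0 -lt0n (ltnW n2).
apply: minimax_risk_ge => that.
have [||x|t x Nt|t x a b Nt ab|x] := multiary_assouad (M := 2)
  (P := [pred t | (0 < @block_size n k t)%N]) (c := @staircase_class n k)
  (theta := theta) (Delta := 1 / 4) (fun A e => that A e.1 e.2) => //.
- exact: sbm_space_edge_probabilities.
- pose q : 'M[R]_n := \matrix_(i, j) if staircase_class k (i, j) == t then 1 / 2
                         else theta x i j.
  have qE e : below e -> q e.1 e.2 =
      if staircase_class k e == t then 1 / 2 else theta x e.1 e.2.
    by case: e => i j; rewrite mxE.
  have q_int : interior q.
    move=> e be; rewrite qE //; case: ifP => _; first by lra.
    rewrite /theta (sbm_matrix_below _ _ be).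
    by have := Q_itv x (staircase_label k e.1) (staircase_label k e.2); lra.
  exists q => // a.
  have off e : below e -> staircase_class k e != t ->
      theta (set_coordinate x t a) e.1 e.2 = theta x e.1 e.2.
    by move=> be /negbTE et; rewrite !thetaE // ffunE et.
  apply: le_trans (chi_square_le q_int _) _ => [e be|].
    by rewrite qE //; case: eqP => [_|/eqP et]; [right | left; rewrite off].
  have -> : \sum_(e | below e)
      (theta (set_coordinate x t a) e.1 e.2 - q e.1 e.2) ^+ 2 = 1 / 16.
    rewrite -(Nd2 t Nt) mulr_natl -sumr_const big_mkcond [RHS]big_mkcond.
    apply: eq_bigr => e _; rewrite inE; case: ifP => //= be.
    rewrite qE //; case: eqP => [et|/eqP et]; last first.
      by rewrite off // subrr expr0n.
    by rewrite thetaE // et ffunE eqxx addrAC subrr add0r exprMn sg2 mulr1.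
  have -> : 4 * (1 / 16) = 1 / 4 :> R by field.
  by rewrite (le_trans (expR_quarter_le R)) //; lra.
- apply: le_trans (_ : \sum_(e | below e && (staircase_class k e == t))
      4 * d t ^+ 2 <= _).
    have -> : 1 / 4 = 4 * (N t * d t ^+ 2) by rewrite Nd2 //; field.
    rewrite mulrCA [leLHS]mulr_natl -sumr_const le_eqVlt; apply/orP; left.
    by apply/eqP/eq_bigl => e; rewrite inE.
  apply: ler_sum => e /andP[be /eqP et].
  rewrite !thetaE // et !ffunE eqxx opprD addrACA subrr add0r -mulrBr exprMn.
  rewrite mulrC ler_wpM2l ?sqr_ge0 //.
  move: a b ab => [[|[|//]] ?] [[|[|//]] ?] //= _; rewrite /sg /= ?expr1 ?expr0; lra.
- move=> risk_x; exists (theta x) => //; apply: le_trans risk_x.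
  by rewrite ler_wpM2r ?card_nonempty_blocks.
Qed.

(** * The lower bound from the unknown labels *)

(** [-1] to the number of common ones among the [s] lowest binary digits of [a] and
    [b], that is, the Hadamard matrix of Sylvester.  It is symmetric, as it must be
    to serve as a matrix of connection probabilities of an undirected graph. *)
Fixpoint walsh (R : realType) (s a b : nat) : R :=
  if s is s'.+1 then (-1) ^+ (odd a && odd b) * walsh R s' a./2 b./2 else 1.

Lemma walsh_sym (R : realType) s a b : walsh R s a b = walsh R s b a.
Proof. by elim: s a b => //= s IH a b; rewrite andbC IH. Qed.

Lemma walsh_itv (R : realType) s a b : -1 <= walsh R s a b <= 1.
Proof.
elim: s a b => [|s IH] a b /=; first by lra.
have /andP[? ?] := IH a./2 b./2.
by case: (odd a && odd b); rewrite ?expr1 ?expr0; apply/andP; split; lra.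
Qed.

Lemma walsh_sqr (R : realType) s a b : walsh R s a b ^+ 2 = 1.
Proof.
elim: s a b => [|s IH] a b /=; first by rewrite expr1n.
by rewrite exprMn IH mulr1 -exprM mulnC exprM sqrrN expr1n expr1n.
Qed.

Lemma sum_double (V : nmodType) n (f : nat -> V) :
  \sum_(0 <= c < n.*2) f c = \sum_(0 <= c < n) (f c.*2 + f c.*2.+1).
Proof.
elim: n => [|n IH]; first by rewrite !big_geq.
by rewrite doubleS !big_nat_recr //= IH addrA.
Qed.

Lemma walsh_orthogonal (R : realType) s a b :
  (a < 2 ^ s)%N -> (b < 2 ^ s)%N -> a != b ->
  \sum_(0 <= c < 2 ^ s) walsh R s a c * walsh R s b c = 0.
Proof.
elim: s a b => [|s IH] a b; first by case: a b => [|[|//]] [|[|//]].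
rewrite expnS mul2n => a_lt b_lt ab; rewrite sum_double.
rewrite (eq_bigr (fun c => (walsh R s a./2 c * walsh R s b./2 c) *
    (1 + (-1) ^+ odd a * (-1) ^+ odd b))) => [|c _]; last first.
  by rewrite /= odd_double !doubleK uphalf_double !andbF !andbT expr0; ring.
rewrite -mulr_suml; have [ab2|ab2] := eqVneq a./2 b./2; last first.
  by rewrite IH ?mul0r // ltn_half_double.
have : odd a != odd b.
  apply: contra ab => /eqP odd_ab.
  by rewrite -(odd_double_half a) -(odd_double_half b) ab2 odd_ab.
by case: (odd a) (odd b) => [] [] //= _;
  rewrite expr0 expr1 ?mul1r ?mulr1 subrr mulr0.
Qed.

Lemma walsh_separation (R : realType) s a b :
  (a < 2 ^ s)%N -> (b < 2 ^ s)%N -> a != b ->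
  \sum_(0 <= c < 2 ^ s) (walsh R s a c - walsh R s b c) ^+ 2 = 2 * (2 ^ s)%:R.
Proof.
move=> a_lt b_lt ab.
transitivity (\sum_(0 <= c < 2 ^ s) 2 +
    (-2) * \sum_(0 <= c < 2 ^ s) walsh R s a c * walsh R s b c : R).
  rewrite mulr_sumr -big_split; apply: eq_bigr => c _.
  by rewrite sqrrB !walsh_sqr /=; ring.
by rewrite walsh_orthogonal // mulr0 addr0 big_const_nat subn0 iter_addr_0 mulr_natr.
Qed.

Lemma sum_periodic (V : nmodType) M m (f : nat -> V) :
  \sum_(0 <= j < m * M) f (j %% M)%N = (\sum_(0 <= c < M) f c) *+ m.
Proof.
elim: m => [|m IH]; first by rewrite mul0n big_geq.
rewrite mulSn addnC (big_cat_nat _ (leq_addr _ _)) //= IH mulrSr; congr (_ + _).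
rewrite -{1}[(m * M)%N]add0n big_addn addKn.
rewrite big_nat_cond [RHS]big_nat_cond; apply: eq_bigr => j /andP[/andP[_ jM] _].
by rewrite addnC modnMDl modn_small.
Qed.

(** The nodes [i < n1] get the label [i %% M], and the other nodes free labels in
    ['I_M].  Edges between two free nodes also carry information on their labels,
    but knowing all labels except that of [t] this only concerns the [n - 1] edges
    at [t], which the chi-square bound already counts. *)
Lemma minimax_risk_ge_labels (R : realType) n k : (2 <= k)%N -> (2 * k <= n)%N ->
  ((ln k%:R / (4096 * n%:R))%:E <= minimax_risk (sbm_space R n k))%E.
Proof.
move=> k2 kn.
pose s := trunc_log 2 k; pose M := (2 ^ s)%N.
have /andP[Mk kM] : (M <= k < 2 * M)%N.
  by rewrite /M -expnS; apply: trunc_log_bounds => //; exact: ltnW.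
have M2 : (2 <= M)%N by lia.
pose m := (n %/ (2 * M))%N; pose n1 := (m * M)%N.
have n1n : (2 * n1 <= n)%N.
  by have := leq_trunc_div n (2 * M); rewrite /n1 /m; lia.
have nn1 : (n <= 4 * n1)%N.
  have m_gt0 : (0 < m)%N by rewrite divn_gt0; lia.
  have := ltn_ceil n (_ : 0 < 2 * M)%N; rewrite -/m => /(_ ltac:(lia)).
  have := leq_pmull M m_gt0; rewrite /n1; nia.
have n_gt0 : 0 < n%:R :> R by rewrite ltr0n; lia.
have M_gt0 : 0 < M%:R :> R by rewrite ltr0n; lia.
have lnM_gt0 : 0 < ln M%:R :> R by rewrite ln_gt0 // ltr1n.
have lnM_le : ln M%:R <= n%:R :> R.
  by apply: le_trans (ltW (ln_sublinear M_gt0)) _; rewrite ler_nat; lia.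
(* The constant 16 makes the chi-square bound of the edges at one node, at most
   exp (8 * n * d ^ 2), equal to the square root of M. *)
pose d : R := Num.sqrt (ln M%:R / (16 * n%:R)).
have d2 : d ^+ 2 = ln M%:R / (16 * n%:R).
  by rewrite sqr_sqrtr // divr_ge0 ?mulr_ge0 // ltW.
have d0 : 0 <= d by exact: sqrtr_ge0.
have d_le : d <= 1 / 4.
  rewrite -ler_sqr ?nnegrE // d2 ler_pdivrMr ?mulr_gt0 //; lra.
pose Q : 'M[R]_k := \matrix_(a, b) (1 / 2 + d * walsh R s a b).
have Q_itv a b : 1 / 4 <= Q a b <= 3 / 4.
  by rewrite mxE; have := walsh_itv R s a b; nra.
have Q01 a b : 0 <= Q a b <= 1 by have := Q_itv a b; lra.
have Qsym a b : Q a b = Q b a by rewrite !mxE walsh_sym.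
have M_pos : (0 < M)%N by exact: ltnW.
pose lab (x : {ffun 'I_n -> 'I_M}) (i : 'I_n) : 'I_k :=
  widen_ord Mk (if (i < n1)%N then Ordinal (ltn_pmod i M_pos) else x i).
pose theta x : 'M[R]_n := sbm_matrix Q (lab x).
have th_sbm x : sbm_space R n k (theta x) by exact: sbm_matrix_in_space.
have thetaE x e : below e ->
    theta x e.1 e.2 = 1 / 2 + d * walsh R s (lab x e.1) (lab x e.2).
  by move=> be; rewrite /theta sbm_matrix_below // mxE.
have labE x t a i : i != t -> lab (set_coordinate x t a) i = lab x i.
  by move=> /negbTE it; rewrite /lab ffunE it.
apply: le_trans (_ : (((n%:R ^+ 2)^-1 *
    (#|[pred i : 'I_n | (n1 <= i)%N]|%:R * (ln M%:R / 32 / 32)))%:E <= _)%E).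
  have cardP : (#|[pred i : 'I_n | (n1 <= i)%N]| + n1 = n)%N.
    rewrite -[RHS](card_ord n) -!sum1_card.
    rewrite [RHS](bigID (fun i : 'I_n => (i < n1)%N)) /= addnC; congr (_ + _)%N.
      by rewrite -(big_ord_widen n (fun=> 1%N)) ?sum1_card ?card_ord //; lia.
    by apply: eq_bigl => i; rewrite inE -leqNgt.
  have cardP_ge : n%:R <= 2 * #|[pred i : 'I_n | (n1 <= i)%N]|%:R :> R.
    by rewrite -natrM ler_nat; lia.
  have lnk_le : ln k%:R <= 2 * ln M%:R :> R.
    rewrite mulr_natl -lnXn // -natrX ler_ln ?posrE ?ltr0n ?expn_gt0 ?M_pos //.
      by rewrite ler_nat; nia.
    by lia.
  rewrite lee_fin; apply: le_trans (_ : (n%:R ^+ 2)^-1 *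
      (n%:R / 2 * (ln M%:R / 32 / 32)) <= _).
    rewrite [leRHS](_ : _ = 2 * ln M%:R / (4096 * n%:R)); last first.
      by field; rewrite gt_eqF.
    apply: ler_wpM2r lnk_le.
    by rewrite invr_ge0 mulr_ge0 ?ler0n.
  rewrite ler_wpM2l ?invr_ge0 ?sqr_ge0 // ler_wpM2r ?divr_ge0 ?(ltW lnM_gt0) //.
  by rewrite ler_pdivrMr // mulrC.
apply: minimax_risk_ge => that.
have [|||t x Pt|t x a b Pt ab|x] := multiary_assouad (M := M)
  (P := [pred i : 'I_n | (n1 <= i)%N]) (c := fst) (theta := theta)
  (Delta := ln M%:R / 32) (fun A e => that A e.1 e.2) => //.
- by rewrite divr_ge0 // ltW.
- by move=> x; exact: sbm_space_edge_probabilities (th_sbm x).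
- pose q : 'M[R]_n := \matrix_(i, j) if (i == t) || (j == t) then 1 / 2
                         else theta x i j.
  have qE e : below e -> q e.1 e.2 =
      if (e.1 == t) || (e.2 == t) then 1 / 2 else theta x e.1 e.2.
    by rewrite mxE.
  have q_int : interior q.
    move=> e be; rewrite qE //; case: ifP => _; first by lra.
    rewrite /theta sbm_matrix_below //.
    by have := Q_itv (lab x e.1) (lab x e.2); lra.
  exists q => // a.
  have off e : below e -> ~~ ((e.1 == t) || (e.2 == t)) ->
      theta (set_coordinate x t a) e.1 e.2 = theta x e.1 e.2.
    by move=> be; rewrite negb_or => /andP[e1 e2]; rewrite !thetaE // !labE.
  apply: le_trans (chi_square_le q_int _) _ => [e be|].
    by rewrite qE //; case: ifPn => [_|et]; [right | left; rewrite off].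
  have le_d2 : \sum_(e | below e)
      (theta (set_coordinate x t a) e.1 e.2 - q e.1 e.2) ^+ 2 <= 2 * (n%:R * d ^+ 2).
    apply: le_trans (_ : \sum_(e : 'I_n * 'I_n)
        ((e.1 == t)%:R * d ^+ 2 + (e.2 == t)%:R * d ^+ 2) <= _).
      rewrite big_mkcond; apply: ler_sum => e _.
      have rhs0 (b c : bool) : 0 <= b%:R * d ^+ 2 + c%:R * d ^+ 2.
        by rewrite addr_ge0 // mulr_ge0 ?sqr_ge0.
      case: ifP => // be; rewrite qE //.
      case: ifPn => [et|et]; last by rewrite off // subrr expr0n.
      rewrite thetaE // addrAC subrr add0r exprMn walsh_sqr mulr1.
      have := sqr_ge0 d; move: et.
      by case: (e.1 == t); case: (e.2 == t) => //=; lra.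
    have count : \sum_(i < n) \sum_(j < n) (i == t)%:R * d ^+ 2 = n%:R * d ^+ 2.
      rewrite exchange_big /= -[in RHS](card_ord n) mulr_natl -sumr_const.
      apply: eq_bigr => j _; rewrite -mulr_suml (bigD1 t) //= eqxx big1 ?addr0 ?mul1r //.
      by move=> i /negbTE->.
    rewrite big_split /= -(pair_big xpredT xpredT (fun i j => (i == t)%:R * d ^+ 2)).
    rewrite -(pair_big xpredT xpredT (fun i j => (j == t)%:R * d ^+ 2)) /=.
    rewrite [X in _ + X]exchange_big /= count; lra.
  apply: le_trans (_ : expR (ln M%:R / 2) <= _).
    rewrite ler_expR; apply: le_trans (_ : 4 * (2 * (n%:R * d ^+ 2)) <= _).
      by rewrite ler_wpM2l.
    rewrite le_eqVlt; apply/orP; left; apply/eqP; rewrite d2; field.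
    by rewrite gt_eqF.
  have root : expR (ln M%:R / 2) ^+ 2 = M%:R :> R.
    by rewrite -expRM_natl mulrCA divff // mulr1 lnK.
  have M2R : 2 <= M%:R :> R by rewrite ler_nat.
  have root_ge : 4 / 3 <= expR (ln M%:R / 2) :> R.
    by rewrite -ler_sqr ?nnegrE ?expR_ge0 ?divr_ge0 // root; lra.
  have : 0 <= expR (ln M%:R / 2) * (expR (ln M%:R / 2) - 4 / 3 : R).
    by rewrite mulr_ge0 ?expR_ge0 // subr_ge0.
  lra.
- have sep := walsh_separation R (ltn_ord a) (ltn_ord b) ab.
  pose F (j : nat) : R := (d * (walsh R s a j - walsh R s b j)) ^+ 2.
  apply: le_trans (_ : \sum_(j < n | (j < n1)%N) F (j %% M)%N <= _).
    rewrite -(big_ord_widen n (fun j => F (j %% M)%N)); last by lia.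
    rewrite -(big_mkord xpredT (fun j => F (j %% M)%N)) sum_periodic.
    under eq_bigr => j _ do rewrite /F exprMn.
    rewrite -mulr_sumr sep d2 -/M -[leRHS]mulr_natl.
    have nn1R : n%:R <= 4 * (m%:R * M%:R) :> R by rewrite -!natrM ler_nat.
    rewrite [leRHS](_ : _ =
       4 * (m%:R * M%:R) / n%:R * (ln M%:R / 32)); last by field; rewrite gt_eqF.
    rewrite ler_peMl ?divr_ge0 // ?(ltW lnM_gt0) //.
    by rewrite ler_pdivlMr // mul1r.
  have -> : \sum_(e | below e && (fst e == t))
      (theta (set_coordinate x t a) e.1 e.2 -
       theta (set_coordinate x t b) e.1 e.2) ^+ 2 =
     \sum_(j < n | (j < t)%N)
      (theta (set_coordinate x t a) t j - theta (set_coordinate x t b) t j) ^+ 2.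
    pose G i j : R :=
      (theta (set_coordinate x t a) i j - theta (set_coordinate x t b) i j) ^+ 2.
    transitivity (\sum_(i | i == t) \sum_(j < n | (j < i)%N) G i j).
      by rewrite pair_big_dep; apply: eq_bigl => e; rewrite andbC.
    by rewrite big_pred1_eq.
  rewrite big_mkcond [leRHS]big_mkcond; apply: ler_sum => j _.
  case: ifP => jn1; last by case: ifP => // _; exact: sqr_ge0.
  have jt : (j < t)%N by exact: leq_trans jn1 Pt.
  have tn1 : (t < n1)%N = false by apply/negbTE; rewrite -leqNgt.
  have be : below (t, j) by [].
  rewrite jt !(thetaE _ _ be) /= /lab jn1.
  rewrite tn1 !ffunE eqxx /F; lra.
- by move=> risk_x; exists (theta x).
Qed.

(** * The two rates together *)

(** When [2 * k > n] the parametric rate dominates the clustering rate, since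
    [ln k <= k]. *)
Lemma minimax_risk_lower (R : realType) n k : (2 <= n)%N -> (1 <= k <= n)%N ->
  ((8192^-1 * sbm_rate R n k)%:E <= minimax_risk (sbm_space R n k))%E.
Proof.
move=> n2 kn; have /andP[k1 _] := kn.
have param := minimax_risk_ge_parametric R n2 kn.
have n_gt0 : 0 < n%:R :> R by rewrite ltr0n ltnW.
have k_ge1 : 1 <= k%:R :> R by rewrite ler1n.
set r1 : R := k%:R ^+ 2 / n%:R ^+ 2; set r2 : R := ln k%:R / n%:R.
have r1_ge0 : 0 <= r1 by rewrite divr_ge0 ?sqr_ge0.
have r2_ge0 : 0 <= r2 by rewrite divr_ge0 ?ln_ge0 ?ler0n.
have param_r1 : ((r1 / 512)%:E <= minimax_risk (sbm_space R n k))%E.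
  suff -> : r1 / 512 = k%:R ^+ 2 / (512 * n%:R ^+ 2) by [].
  by rewrite /r1; field; rewrite gt_eqF.
have labels : r2 <= 2 * r1 \/
    ((r2 / 4096)%:E <= minimax_risk (sbm_space R n k))%E.
  have [k_le1|k2] := leqP k 1.
    left; have -> : r2 = 0 by rewrite /r2 (_ : k = 1%N) ?ln1 ?mul0r //; lia.
    by rewrite mulr_ge0.
  have [kn2|kn2] := leqP (2 * k) n.
    right; suff -> : r2 / 4096 = ln k%:R / (4096 * n%:R).
      exact: minimax_risk_ge_labels.
    by rewrite /r2; field; rewrite gt_eqF.
  left; rewrite [leRHS](_ : _ = 2 * k%:R ^+ 2 / n%:R / n%:R); last first.
    by rewrite /r1; field; rewrite gt_eqF.
  rewrite ler_wpM2r ?invr_ge0 ?ler0n // ler_pdivlMr //.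
  have lnk_le : ln k%:R <= k%:R :> R by rewrite ltW // ln_sublinear // ltr0n.
  apply: le_trans (_ : k%:R * n%:R <= _); first by rewrite ler_wpM2r ?ler0n.
  rewrite expr2 mulrCA ler_wpM2l ?ler0n // -natrM ler_nat; exact: ltnW.
rewrite /sbm_rate -/r1 -/r2.
have [r12|r12] := leP r2 (8 * r1).
  by apply: le_trans param_r1; rewrite lee_fin; lra.
case: labels => [r21|labels].
  by have := lt_le_trans r12 r21; rewrite ltNge ler_wpM2r ?ler_nat.
by apply: le_trans labels; rewrite lee_fin; lra.
Qed.

(* For n = k = 1 the space sbm_space is {0} and the minimax risk is 0 while the
   rate is 1, so the lower bound is only asserted for n >= 2. *)
Theorem theorem1p1 (R : realType) :
  exists C : R, 0 < C /\
    forall n k : nat, (1 <= k <= n)%N ->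
      ((2 <= n)%N ->
        ((C^-1 * sbm_rate R n k)%:E <= minimax_risk (sbm_space R n k))%E) /\
      (minimax_risk (sbm_space R n k) <= (C * sbm_rate R n k)%:E)%E.
Proof.
exists 8192; split=> [|n k kn]; first by rewrite ltr0n.
split=> [n2|]; first exact: minimax_risk_lower.
apply: le_trans (minimax_risk_upper R kn) _; rewrite lee_fin.
apply: ler_wpM2r; last by rewrite ler_nat.
have /andP[k1 _] := kn.
apply: addr_ge0; first by rewrite divr_ge0 ?sqr_ge0.
by rewrite divr_ge0 ?ln_ge0 ?ler0n ?ler1n.
Qed.
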